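(* Let $k$ be a field, let $D=k[s,t]_{(s,t)}$ be the localization of the polynomial ring $k[s,t]$ at the ideal $(s,t)$, and let $\mathfrak{m}=(s,t)$ be the unique maximal ideal of $D$. Set $$M=\bigoplus_{0\neq g\in\mathfrak{m}} D/gD.$$ Let $A=D\ast M$, let $I=((s,0),(t,0))A$ be the ideal of $A$ generated by $(s,0)$ and $(t,0)$, and let $B=A\ast (A/I)$. Then $B$ is HMCM, but the polynomial ring $B[X]$ is not HMCM.
   Context: All rings are commutative with identity. Idealization: for a ring $R$ and an $R$-module $N$, $R\ast N$ is the ring with underlying group $R\oplus N$ and multiplication $(a,x)(b,y)=(ab,ay+bx)$. Weakly proregular sequences: for $\underline{a}=a_1,\dots,a_r\in R$ and $n\geq 0$ write $\underline{a}^n=a_1^n,\dots,a_r^n$ and let $H_i(\underline{a}^n)$ be the $i$-th Koszul homology of $\underline{a}^n$ on $R$. For $m\geq n$ there is a natural map $\varphi_{mn}\colon H_i(\underline{a}^m)\to H_i(\underline{a}^n)$ induced by the tensor product over $j$ of the chain maps $K_\bullet(a_j^m)\to K_\bullet(a_j^n)$ which are the identity in degree $0$ and multiplication by $a_j^{m-n}$ in degree $1$. The sequence $\underline{a}$ is weakly proregular if for every $1\leq i\leq r$ and every $n\geq 0$ there is $m\geq n$ with $\varphi_{mn}=0$. Parameter sequences: $\underline{a}=a_1,\dots,a_r$ is a parameter sequence if (1) it is weakly proregular; (2) $\underline{a}R\neq R$; (3) for every prime ideal $P$ containing $\underline{a}$, $\check{H}^r(\underline{a},R)_P\neq 0$,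 where $\check{H}^r(\underline{a},R)$ is the $r$-th cohomology of the Čech complex of $\underline{a}$ on $R$. It is a strong parameter sequence if $a_1,\dots,a_i$ is a parameter sequence for every $i=1,\dots,r$. HMCM: $R$ is HMCM (Cohen–Macaulay in the sense of Hamilton–Marley) if every strong parameter sequence of $R$ is a regular sequence on $R$ (each $a_i$ is a non-zero-divisor on $R/(a_1,\dots,a_{i-1})R$, and $R/\underline{a}R\neq 0$). *)

(* Defs.v *)
From HB Require Import structures.
From mathcomp Require Import all_boot all_order all_algebra ring.
From mathcomp.classical Require Import boolp.
From mathcomp.multinomials Require Import mpoly.

Set Implicit Arguments.
Unset Strict Implicit.
Unset Printing Implicit Defensive.

Import GRing.Theory.
Import Quotient.
Local Open Scope ring_scope.
Local Open Scope quotient_scope.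

(* A submodule is a submodClosed predicate. MathComp's {quot _} asks for a
   zmodClosed one, which submodClosed does not provide by inheritance. *)
Definition zmod_of_submod (R : comNzRingType) (N : lmodType R)
  (S : submodClosed N) : {pred N} := fun x => x \in S.

Section ZmodOfSubmod.
Variables (R : comNzRingType) (N : lmodType R) (S : submodClosed N).

Fact zmod_of_submod_closed : zmod_closed (zmod_of_submod S).
Proof.
split; first exact: (rpred0 S).
move=> x y Sx Sy; rewrite /zmod_of_submod -[- y]scaleN1r.
have h := rpredZ (-1) Sy. exact: (rpredD Sx h).
Qed.
HB.instance Definition _ :=
  GRing.isZmodClosed.Build N (zmod_of_submod S) zmod_of_submod_closed.
End ZmodOfSubmod.

Section ModQuotient.
Variables (R : comNzRingType) (N : lmodType R) (S : submodClosed N).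

Definition modquot := {quot (zmod_of_submod S : zmodClosed N)}.
HB.instance Definition _ := GRing.Zmodule.on modquot.

Definition modquot_pi (x : N) : modquot := \pi_modquot x.

Definition modquot_scale (a : R) (u : modquot) : modquot :=
  modquot_pi (a *: repr u).

Lemma modquot_eqP (x y : N) :
  reflect (modquot_pi x = modquot_pi y) (x - y \in S).
Proof.
rewrite /modquot_pi; apply: (iffP idP) => [h|/eqmodP].
  by apply/eqmodP; rewrite /= /equiv.
by rewrite /= /equiv.
Qed.

Lemma modquot_piK (u : modquot) : modquot_pi (repr u) = u.
Proof. exact: reprK. Qed.

Lemma modquot_piZ a x : modquot_scale a (modquot_pi x) = modquot_pi (a *: x).
Proof.
apply/modquot_eqP; rewrite -scalerBr; apply: rpredZ.
by apply/modquot_eqP; rewrite modquot_piK.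
Qed.

Lemma modquot_piD x y : modquot_pi (x + y) = modquot_pi x + modquot_pi y.
Proof. exact: (raddfD \pi_modquot). Qed.

Fact modquot_scaleA a b u :
  modquot_scale a (modquot_scale b u) = modquot_scale (a * b) u.
Proof. by rewrite -[u]modquot_piK !modquot_piZ scalerA. Qed.
Fact modquot_scale1 : left_id 1 modquot_scale.
Proof. by move=> u; rewrite -[u]modquot_piK !modquot_piZ scale1r. Qed.
Fact modquot_scaleDr : right_distributive modquot_scale +%R.
Proof.
move=> a u v; rewrite -[u]modquot_piK -[v]modquot_piK -modquot_piD.
by rewrite !modquot_piZ -modquot_piD scalerDr.
Qed.
Fact modquot_scaleDl u : {morph modquot_scale^~ u : a b / a + b}.
Proof.
by move=> a b; rewrite -[u]modquot_piK !modquot_piZ -modquot_piD scalerDl.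
Qed.
HB.instance Definition _ := GRing.Zmodule_isLmodule.Build R modquot
  modquot_scaleA modquot_scale1 modquot_scaleDr modquot_scaleDl.
End ModQuotient.

Section Submodule.
Variables (R : comNzRingType) (N : lmodType R) (S : submodClosed N).

Record submodule := Submodule { submodule_val :> N; _ : submodule_val \in S }.
HB.instance Definition _ := [isSub for submodule_val].
HB.instance Definition _ := [Choice of submodule by <:].
HB.instance Definition _ := [SubChoice_isSubLmodule of submodule by <:].
End Submodule.

Definition ideal_gen (R : comNzRingType) (a : seq R) : {pred R^o} :=
  fun x => `[< exists c : nat -> R, x = \sum_(i < size a) c i * a`_i >].

Section IdealGen.
Variables (R : comNzRingType) (a : seq R).

Fact ideal_gen_closed : submod_closed (ideal_gen a).
Proof.
split.
  apply/asboolP; exists (fun=> 0).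
  by rewrite big1 // => i _; rewrite mul0r.
move=> b x y /asboolP[c ->] /asboolP[d ->]; apply/asboolP.
exists (fun i => b * c i + d i); rewrite scaler_sumr -big_split /=.
by apply: eq_bigr => i _; rewrite mulrDl -mulrA.
Qed.
HB.instance Definition _ :=
  GRing.isSubmodClosed.Build R R^o (ideal_gen a)
    (GRing.submod_closed_semi ideal_gen_closed).
End IdealGen.

Section DependentProduct.
Variables (R : comNzRingType) (I : Type) (V : I -> lmodType R).

Definition dprodm := forall i, V i.
HB.instance Definition _ := Choice.copy dprodm (forall i, V i).

Implicit Types f g : dprodm.
Definition dprodm_zero : dprodm := fun=> 0.
Definition dprodm_add f g : dprodm := fun i => f i + g i.
Definition dprodm_opp f : dprodm := fun i => - f i.
Definition dprodm_scale (a : R) f : dprodm := fun i => a *: f i.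

Fact dprodm_addA : associative dprodm_add.
Proof. by move=> f g h; apply: functional_extensionality_dep => i; apply: addrA. Qed.
Fact dprodm_addC : commutative dprodm_add.
Proof. by move=> f g; apply: functional_extensionality_dep => i; apply: addrC. Qed.
Fact dprodm_add0 : left_id dprodm_zero dprodm_add.
Proof. by move=> f; apply: functional_extensionality_dep => i; apply: add0r. Qed.
Fact dprodm_addN : left_inverse dprodm_zero dprodm_opp dprodm_add.
Proof. by move=> f; apply: functional_extensionality_dep => i; apply: addNr. Qed.
HB.instance Definition _ := GRing.isZmodule.Build dprodm
  dprodm_addA dprodm_addC dprodm_add0 dprodm_addN.

Fact dprodm_scaleA a b f :
  dprodm_scale a (dprodm_scale b f) = dprodm_scale (a * b) f.
Proof. by apply: functional_extensionality_dep => i; apply: scalerA. Qed.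
Fact dprodm_scale1 : left_id 1 dprodm_scale.
Proof. by move=> f; apply: functional_extensionality_dep => i; apply: scale1r. Qed.
Fact dprodm_scaleDr : right_distributive dprodm_scale +%R.
Proof. by move=> a f g; apply: functional_extensionality_dep => i; apply: scalerDr. Qed.
Fact dprodm_scaleDl f : {morph dprodm_scale^~ f : a b / a + b}.
Proof. by move=> a b; apply: functional_extensionality_dep => i; apply: scalerDl. Qed.
HB.instance Definition _ := GRing.Zmodule_isLmodule.Build R dprodm
  dprodm_scaleA dprodm_scale1 dprodm_scaleDr dprodm_scaleDl.

Lemma dprodmDE f g i : (f + g) i = f i + g i. Proof. by []. Qed.
Lemma dprodmZE a f i : (a *: f) i = a *: f i. Proof. by []. Qed.
Lemma dprodm0E i : (0 : dprodm) i = 0. Proof. by []. Qed.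
End DependentProduct.

Section DirectSum.
Variables (R : comNzRingType) (I : eqType) (V : I -> lmodType R).

Definition finsupp : {pred dprodm V} :=
  fun f => `[< exists s : seq I, forall i, f i != 0 -> i \in s >].

Fact finsupp_closed : submod_closed finsupp.
Proof.
split; first by apply/asboolP; exists [::] => i; rewrite dprodm0E eqxx.
move=> a f g /asboolP[s sf] /asboolP[t tg]; apply/asboolP.
exists (s ++ t) => i; rewrite dprodmDE dprodmZE mem_cat => h.
have [f0|/sf->//] := eqVneq (f i) 0.
by rewrite tg ?orbT //; move: h; rewrite f0 scaler0 add0r.
Qed.
HB.instance Definition _ :=
  GRing.isSubmodClosed.Build R (dprodm V) finsupp
    (GRing.submod_closed_semi finsupp_closed).

Definition dsum := submodule finsupp.
HB.instance Definition _ := GRing.Lmodule.on dsum.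
End DirectSum.

Section Localization.
Variables (R : comNzRingType) (S : mulrClosed R) (N : lmodType R).

Definition denom := {s : R | s \in S}.
HB.instance Definition _ := Choice.on denom.

Definition denom1 : denom := exist _ 1 (rpred1 S).
Definition denomM (s t : denom) : denom :=
  exist _ (sval s * sval t) (rpredM (valP s) (valP t)).

Definition loc_equiv (p q : N * denom) : bool :=
  `[< exists2 u, u \in S &
        u *: (sval q.2 *: p.1) = u *: (sval p.2 *: q.1) >].

Fact loc_equiv_refl : reflexive loc_equiv.
Proof. by move=> p; apply/asboolP; exists 1; rewrite ?rpred1. Qed.
Fact loc_equiv_sym : ssrbool.symmetric loc_equiv.
Proof.
by move=> p q; apply/asboolP/asboolP => -[u Su e]; exists u; rewrite ?e.
Qed.
Fact loc_equiv_trans : transitive loc_equiv.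
Proof.
move=> [y t] [x s] [z r] /asboolP[u Su /= e1] /asboolP[v Sv /= e2].
apply/asboolP; exists (u * v * sval t); first by rewrite !rpredM ?(valP t).
rewrite /=; move: e1 e2; rewrite !scalerA => e1 e2.
have -> : u * v * sval t * sval r = v * sval r * (u * sval t) by ring.
rewrite -scalerA e1 scalerA.
have -> : v * sval r * (u * sval s) = u * sval s * (v * sval r) by ring.
by rewrite -scalerA e2 scalerA; congr (_ *: _); ring.
Qed.
Canonical loc_equiv_equiv :=
  EquivRel loc_equiv loc_equiv_refl loc_equiv_sym loc_equiv_trans.

Definition loc := {eq_quot loc_equiv}.
HB.instance Definition _ := Choice.on loc.
HB.instance Definition _ := EqQuotient.on loc.

Definition frac (x : N) (s : denom) : loc := \pi_loc (x, s).

Lemma frac_eqP x s y t :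
  (exists2 u, u \in S & u *: (sval t *: x) = u *: (sval s *: y)) <->
  frac x s = frac y t.
Proof.
by split => [h|/eqmodP/asboolP//]; apply/eqmodP; apply/asboolP.
Qed.

Definition num (z : loc) : N := (repr z).1.
Definition den (z : loc) : denom := (repr z).2.

Lemma frac_numden z : frac (num z) (den z) = z.
Proof. by rewrite /frac -surjective_pairing reprK. Qed.

Lemma fracP z : exists x s, z = frac x s.
Proof. by exists (num z), (den z); rewrite frac_numden. Qed.

Definition loc_zero : loc := frac 0 denom1.
Definition loc_add (z w : loc) : loc :=
  frac (sval (den w) *: num z + sval (den z) *: num w) (denomM (den z) (den w)).
Definition loc_opp (z : loc) : loc := frac (- num z) (den z).
Definition loc_scale (a : R) (z : loc) : loc := frac (a *: num z) (den z).

Lemma frac_numdenP x s :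
  exists2 u, u \in S &
    u *: (sval s *: num (frac x s)) = u *: (sval (den (frac x s)) *: x).
Proof. by apply/frac_eqP; rewrite frac_numden. Qed.

Lemma fracD x s y t : loc_add (frac x s) (frac y t) =
  frac (sval t *: x + sval s *: y) (denomM s t).
Proof.
have [u Su e1] := frac_numdenP x s; have [v Sv e2] := frac_numdenP y t.
apply/frac_eqP; exists (u * v); first exact: rpredM.
move: (num (frac x s)) (den (frac x s)) e1 => x' s' e1.
move: (num (frac y t)) (den (frac y t)) e2 => y' t' e2 /=.
rewrite !scalerDr !scalerA; congr (_ + _).
  transitivity ((v * sval t * sval t') *: (u *: (sval s *: x'))).
    by rewrite !scalerA; congr (_ *: _); ring.
  by rewrite e1 !scalerA; congr (_ *: _); ring.
transitivity ((u * sval s * sval s') *: (v *: (sval t *: y'))).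
  by rewrite !scalerA; congr (_ *: _); ring.
by rewrite e2 !scalerA; congr (_ *: _); ring.
Qed.

Lemma fracN x s : loc_opp (frac x s) = frac (- x) s.
Proof.
have [u Su e] := frac_numdenP x s.
by apply/frac_eqP; exists u => //; rewrite !scalerN e.
Qed.

Lemma fracZ a x s : loc_scale a (frac x s) = frac (a *: x) s.
Proof.
have [u Su e] := frac_numdenP x s.
apply/frac_eqP; exists u => //; rewrite !scalerA.
transitivity (a *: (u *: (sval s *: num (frac x s)))).
  by rewrite !scalerA; congr (_ *: _); ring.
by rewrite e !scalerA; congr (_ *: _); ring.
Qed.

Lemma frac_eq x s y t : sval t *: x = sval s *: y -> frac x s = frac y t.
Proof. by move=> e; apply/frac_eqP; exists 1; rewrite ?rpred1 ?e. Qed.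

Fact loc_addA : associative loc_add.
Proof.
move=> z1 z2 z3; have [x [s ->]] := fracP z1; have [y [t ->]] := fracP z2.
have [w [r ->]] := fracP z3; rewrite !fracD; apply: frac_eq => /=.
by rewrite !scalerDr !scalerA addrA; do 2?congr (_ + _); congr (_ *: _); ring.
Qed.
Fact loc_addC : commutative loc_add.
Proof.
move=> z1 z2; have [x [s ->]] := fracP z1; have [y [t ->]] := fracP z2.
by rewrite !fracD; apply: frac_eq => /=; rewrite addrC mulrC.
Qed.
Fact loc_add0 : left_id loc_zero loc_add.
Proof.
move=> z; have [x [s ->]] := fracP z; rewrite fracD; apply: frac_eq => /=.
by rewrite scaler0 add0r scale1r mul1r.
Qed.
Fact loc_addN : left_inverse loc_zero loc_opp loc_add.
Proof.
move=> z; have [x [s ->]] := fracP z; rewrite fracN fracD; apply: frac_eq => /=.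
by rewrite scalerN addNr !scaler0.
Qed.
HB.instance Definition _ := GRing.isZmodule.Build loc
  loc_addA loc_addC loc_add0 loc_addN.

Fact loc_scaleA a b z : loc_scale a (loc_scale b z) = loc_scale (a * b) z.
Proof. by have [x [s ->]] := fracP z; rewrite !fracZ scalerA. Qed.
Fact loc_scale1 : left_id 1 loc_scale.
Proof. by move=> z; have [x [s ->]] := fracP z; rewrite fracZ scale1r. Qed.
Fact loc_scaleDr : right_distributive loc_scale +%R.
Proof.
move=> a z1 z2; have [x [s ->]] := fracP z1; have [y [t ->]] := fracP z2.
rewrite [_ + _]fracD !fracZ [RHS]fracD.
by rewrite scalerDr !scalerA ![_ * a]mulrC.
Qed.
Fact loc_scaleDl z : {morph loc_scale^~ z : a b / a + b}.
Proof.
move=> a b; have [x [s ->]] := fracP z; rewrite !fracZ [RHS]fracD.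
apply: frac_eq => /=.
by rewrite -scalerDr -scalerDl !scalerA mulrA.
Qed.
HB.instance Definition _ := GRing.Zmodule_isLmodule.Build R loc
  loc_scaleA loc_scale1 loc_scaleDr loc_scaleDl.

Lemma frac_addE x s y t :
  frac x s + frac y t = frac (sval t *: x + sval s *: y) (denomM s t).
Proof. exact: fracD. Qed.
Lemma frac_oppE x s : - frac x s = frac (- x) s.
Proof. exact: fracN. Qed.
Lemma frac_scaleE a x s : a *: frac x s = frac (a *: x) s.
Proof. exact: fracZ. Qed.
Lemma frac0E : 0 = frac 0 denom1. Proof. by []. Qed.
End Localization.

Section LocalizationMap.
Variables (R : comNzRingType) (S S' : mulrClosed R) (N : lmodType R).
Hypothesis SS' : forall s, s \in S -> exists c, c * s \in S'.

(* x / s |-> (c x) / (c s) for any c with c s in S'; loc_map_frac shows that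
   the choices of x, s and c do not matter. *)
Definition loc_map (z : loc S N) : loc S' N :=
  let s := den z in
  frac (xchoose (SS' (valP s)) *: num z)
       (exist _ (xchoose (SS' (valP s)) * sval s) (xchooseP (SS' (valP s)))).

Lemma loc_map_frac x s c (cs : c * sval s \in S') :
  loc_map (frac x s) = frac (c *: x) (exist _ (c * sval s) cs).
Proof.
rewrite /loc_map; have [u Su] := frac_numdenP x s.
move: (num (frac x s)) (den (frac x s)) => x' s' e.
set c' := xchoose _; have [v Sv] := SS' Su.
apply/frac_eqP; exists (v * u) => //=; rewrite !scalerA.
transitivity ((v * c * c') *: (u *: (sval s *: x'))).
  by rewrite !scalerA; congr (_ *: _); ring.
by rewrite e !scalerA; congr (_ *: _); ring.
Qed.

Fact loc_map_linear : linear loc_map.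
Proof.
move=> a z1 z2; have [x [s ->]] := fracP z1; have [y [t ->]] := fracP z2.
have [c cs] := SS' (valP s); have [d dt] := SS' (valP t).
rewrite frac_scaleE frac_addE.
have cdst : (c * d) * sval (denomM s t) \in S'.
  rewrite /= (_ : _ * _ = (c * sval s) * (d * sval t)); last by ring.
  exact: rpredM.
rewrite (loc_map_frac _ cs) (loc_map_frac _ dt) (loc_map_frac _ cdst).
rewrite frac_scaleE frac_addE; apply: frac_eq => /=.
by rewrite !scalerDr !scalerA; congr (_ + _); congr (_ *: _); ring.
Qed.
HB.instance Definition _ :=
  GRing.isLinear.Build R (loc S N) (loc S' N) _ loc_map loc_map_linear.
End LocalizationMap.

Section PrimeComplement.
Variables (R : comNzRingType) (P : prime_idealr R).

Definition prime_compl : {pred R} := fun x => x \notin (P : pred R).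

Fact prime_compl_closed : mulr_closed prime_compl.
Proof.
split; first by rewrite -topredE /= /prime_compl idealr1.
move=> x y; rewrite -!topredE /= /prime_compl => Px Py.
by rewrite prime_idealrM negb_or Px.
Qed.
HB.instance Definition _ :=
  GRing.isMulClosed.Build R prime_compl prime_compl_closed.

Lemma prime_compl0 : 0 \notin prime_compl.
Proof. by rewrite -topredE /= /prime_compl idealr0. Qed.

Definition locp := loc prime_compl R^o.
HB.instance Definition _ := GRing.Lmodule.on locp.

Definition locp_one : locp := frac (1 : R^o) (denom1 _).
Definition locp_mul (z w : locp) : locp :=
  frac ((num z : R) * num w : R^o) (denomM (den z) (den w)).

Lemma locp_mul_frac (x y : R^o) s t :
  locp_mul (frac x s) (frac y t) = frac ((x : R) * y : R^o) (denomM s t).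
Proof.
have aux (u v s1 s2 t1 t2 x1 x2 y1 y2 : R) :
    u * (s1 * x2) = u * (s2 * x1) -> v * (t1 * y2) = v * (t2 * y1) ->
    u * v * (s1 * t1 * (x2 * y2)) = u * v * (s2 * t2 * (x1 * y1)).
  move=> e1 e2; transitivity ((u * (s1 * x2)) * (v * (t1 * y2))); first by ring.
  by rewrite e1 e2; ring.
have [u Su e1] := frac_numdenP x s; have [v Sv e2] := frac_numdenP y t.
by apply/frac_eqP; exists (u * v); [exact: rpredM | exact: aux].
Qed.

Fact locp_mulA : associative locp_mul.
Proof.
move=> z1 z2 z3; have [x [s ->]] := fracP z1; have [y [t ->]] := fracP z2.
have [w [r ->]] := fracP z3; rewrite (locp_mul_frac y w) (locp_mul_frac x y) !locp_mul_frac.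
by congr frac; [exact: (@mulrA R) | apply: val_inj; exact: (@mulrA R)].
Qed.
Fact locp_mulC : commutative locp_mul.
Proof.
move=> z1 z2; have [x [s ->]] := fracP z1; have [y [t ->]] := fracP z2.
rewrite !locp_mul_frac.
by congr frac; [exact: (@mulrC R) | apply: val_inj; exact: (@mulrC R)].
Qed.
Fact locp_mul1 : left_id locp_one locp_mul.
Proof.
move=> z; have [x [s ->]] := fracP z; rewrite locp_mul_frac.
by congr frac; [exact: (@mul1r R) | apply: val_inj; exact: (@mul1r R)].
Qed.
Fact locp_mulDl : left_distributive locp_mul +%R.
Proof.
move=> z1 z2 z3; have [x [s ->]] := fracP z1; have [y [t ->]] := fracP z2.
have [w [r ->]] := fracP z3; rewrite frac_addE.
rewrite (locp_mul_frac x w) (locp_mul_frac y w) locp_mul_frac frac_addE.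
have aux (s0 t0 r0 x0 y0 w0 : R) :
    (s0 * r0 * (t0 * r0)) * ((t0 * x0 + s0 * y0) * w0) =
    (s0 * t0 * r0) * (t0 * r0 * (x0 * w0) + s0 * r0 * (y0 * w0)) by ring.
by apply: frac_eq; exact: aux.
Qed.
Fact locp_one_neq0 : locp_one != 0.
Proof.
apply/eqP => /frac_eqP[u Su]; rewrite /GRing.scale /= !mul1r mulr1 mulr0 => u0.
by move: Su; rewrite u0 (negPf prime_compl0).
Qed.
HB.instance Definition _ := GRing.Zmodule_isComNzRing.Build locp
  locp_mulA locp_mulC locp_mul1 locp_mulDl locp_one_neq0.

Definition to_locp (x : R) : locp := frac (x : R^o) (denom1 _).
End PrimeComplement.

Section Powers.
Variables (R : comNzRingType) (f : R).

Definition powers : {pred R} := fun x => `[< exists n, x = f ^+ n >].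

Fact powers_closed : mulr_closed powers.
Proof.
split; first by apply/asboolP; exists 0%N; rewrite expr0.
move=> x y /asboolP[m ->] /asboolP[n ->]; apply/asboolP.
by exists (m + n)%N; rewrite exprD.
Qed.
HB.instance Definition _ := GRing.isMulClosed.Build R powers powers_closed.
End Powers.

(* For d restricted to a complex, X the chains in one degree and Y the chains
   in the degree that d maps to X: the homology (ker d on X) / d Y. *)
Section Homology.
Variables (R : comNzRingType) (C : lmodType R) (d : {linear C -> C}).
Variables (X Y : submodClosed C).

Definition cycles : {pred C} := fun x => (x \in X) && (d x == 0).

Fact cycles_closed : submod_closed cycles.
Proof.
split; first by apply/andP; split; [exact: (rpred0 X) | rewrite raddf0].
move=> a x y /andP[Xx /eqP dx] /andP[Xy /eqP dy]; apply/andP; split.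
  by have Xax := rpredZ a Xx; apply: (rpredD Xax Xy).
by rewrite linearP dx dy scaler0 addr0.
Qed.
HB.instance Definition _ := GRing.isSubmodClosed.Build R C cycles
  (GRing.submod_closed_semi cycles_closed).

Definition boundaries : {pred submodule cycles} :=
  fun z => `[< exists2 y, y \in Y & val z = d y >].

Fact boundaries_closed : submod_closed boundaries.
Proof.
split; first by apply/asboolP; exists 0; rewrite ?raddf0 ?(rpred0 Y).
move=> a x y /asboolP[x' Yx ex] /asboolP[y' Yy ey]; apply/asboolP.
exists (a *: x' + y'); last by rewrite !linearP /= ex ey.
by have Yax := rpredZ a Yx; apply: (rpredD Yax Yy).
Qed.
HB.instance Definition _ :=
  GRing.isSubmodClosed.Build R (submodule cycles) boundaries
    (GRing.submod_closed_semi boundaries_closed).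

Definition homology := modquot boundaries.
HB.instance Definition _ := GRing.Lmodule.on homology.
End Homology.

Section HomologyMap.
Variables (R : comNzRingType) (C C' : lmodType R).
Variables (d : {linear C -> C}) (X Y : submodClosed C).
Variables (d' : {linear C' -> C'}) (X' Y' : submodClosed C').
Variable phi : {linear C -> C'}.
Hypothesis phi_cycles : {homo phi : x / x \in cycles d X >-> x \in cycles d' X'}.

(* Independent of the representative by homology_map_pi when phi is a chain
   map that sends Y to Y'. *)
Definition homology_map (z : homology d X Y) : homology d' X' Y' :=
  modquot_pi _ (Submodule (phi_cycles (valP (repr z)))).

Lemma homology_map_pi (x : submodule (cycles d X)) :
  (forall y, y \in Y -> phi y \in Y') -> (forall y, phi (d y) = d' (phi y)) ->
  homology_map (modquot_pi _ x) = modquot_pi _ (Submodule (phi_cycles (valP x))).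
Proof.
move=> phiY phid; apply/modquot_eqP.
set z := modquot_pi _ x; have /modquot_eqP/asboolP[y Yy e] := modquot_piK z.
apply/asboolP; exists (phi y); first exact: phiY.
by rewrite -phid -e /= raddfB.
Qed.
End HomologyMap.

(* Families indexed by the subsets of {0, ..., r-1}: the direct sum of all the
   terms of a Koszul or Cech complex, the subsets of size p giving degree p.
   Degrees are integers so that the term of degree -1 of the latter is 0. *)
Section Homogeneous.
Variables (R : comNzRingType) (r : nat) (V : {set 'I_r} -> lmodType R).

Definition in_deg (p : int) : {pred dprodm V} :=
  fun c => [forall T : {set 'I_r}, (#|T|%:Z != p) ==> (c T == 0)].

Lemma degP p (c : dprodm V) :
  reflect (forall T : {set 'I_r}, #|T|%:Z != p -> c T = 0) (c \in in_deg p).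
Proof.
apply: (iffP forallP) => h T; first by move=> Tp; apply/eqP/(implyP (h T)).
by apply/implyP => /h ->.
Qed.

Fact deg_closed p : submod_closed (in_deg p).
Proof.
split; first by apply/degP.
move=> a c c' /degP hc /degP hc'; apply/degP => T Tp.
by rewrite dprodmDE dprodmZE hc // hc' // scaler0 addr0.
Qed.
HB.instance Definition _ p := GRing.isSubmodClosed.Build R (dprodm V) (in_deg p)
  (GRing.submod_closed_semi (deg_closed p)).
End Homogeneous.

(* (-1) ^+ rank_in j T is the sign for inserting j in T or removing it. *)
Definition rank_in r (j : 'I_r) (T : {set 'I_r}) := #|[set l in T | (l < j)%N]|.

Section Koszul.
Variables (R : comNzRingType) (r : nat).

Definition koszul := @dprodm R {set 'I_r} (fun=> R^o).
HB.instance Definition _ := GRing.Lmodule.on koszul.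

(* e_T |-> \sum_(j in T) (-1)^(rank_in j T) a_j e_(T \ j) *)
Definition koszul_d (a : r.-tuple R) (x : koszul) : koszul :=
  fun T => \sum_(j | j \notin T) ((-1) ^+ rank_in j T * tnth a j) *: x (j |: T).

Fact koszul_d_linear a : linear (koszul_d a).
Proof.
move=> b x y; apply: functional_extensionality_dep => T.
rewrite dprodmDE dprodmZE /koszul_d scaler_sumr -big_split /=.
apply: eq_bigr => j _; rewrite dprodmDE dprodmZE scalerDr !scalerA.
by rewrite [_ * b]mulrC.
Qed.
HB.instance Definition _ a :=
  GRing.isLinear.Build R koszul koszul _ (koszul_d a) (koszul_d_linear a).

Definition koszulH (a : r.-tuple R) (i : nat) :=
  homology (koszul_d a) (@in_deg R r (fun=> R^o) i) (@in_deg R r (fun=> R^o) i.+1).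

Definition tuple_exp (a : r.-tuple R) (n : nat) : r.-tuple R :=
  [tuple tnth a j ^+ n | j < r].

(* The tensor product of the maps 1 in degree 0, a_j^(m - n) in degree 1 *)
Definition koszul_phi (a : r.-tuple R) (m n : nat) (x : koszul) : koszul :=
  fun T => (\prod_(j in T) tnth a j ^+ (m - n)) *: x T.

Fact koszul_phi_linear a m n : linear (koszul_phi a m n).
Proof.
move=> b x y; apply: functional_extensionality_dep => T.
rewrite dprodmDE dprodmZE /koszul_phi scalerDr dprodmZE !scalerA.
by rewrite [_ * b]mulrC.
Qed.
HB.instance Definition _ a m n := GRing.isLinear.Build R koszul koszul _
  (koszul_phi a m n) (koszul_phi_linear a m n).

Lemma koszul_phi_d a m n : (n <= m)%N -> forall x,
  koszul_phi a m n (koszul_d (tuple_exp a m) x) =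
  koszul_d (tuple_exp a n) (koszul_phi a m n x).
Proof.
move=> nm x; apply: functional_extensionality_dep => T.
rewrite /koszul_phi /koszul_d scaler_sumr; apply: eq_bigr => j jT.
rewrite !scalerA !tnth_mktuple big_setU1 //=; congr (_ *: _).
have -> : tnth a j ^+ m = tnth a j ^+ n * tnth a j ^+ (m - n).
  by rewrite -exprD subnKC.
by ring.
Qed.

Lemma koszul_phi_deg a m n p x : x \in @in_deg R r (fun=> R^o) p ->
  koszul_phi a m n x \in @in_deg R r (fun=> R^o) p.
Proof.
move=> /degP h; apply/degP => T Tp.
by rewrite /koszul_phi h // scaler0.
Qed.

Fact koszul_phi_cycles a m n i : (n <= m)%N ->
  {homo koszul_phi a m n : x /
    x \in cycles (koszul_d (tuple_exp a m)) (@in_deg R r (fun=> R^o) i) >->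
    x \in cycles (koszul_d (tuple_exp a n)) (@in_deg R r (fun=> R^o) i)}.
Proof.
move=> nm x /andP[hx /eqP dx]; apply/andP; split.
  exact: koszul_phi_deg.
apply/eqP; apply: etrans (esym (koszul_phi_d a nm x)) _.
by apply: etrans (congr1 (koszul_phi a m n) dx) _; exact: raddf0.
Qed.

Definition koszulH_phi (a : r.-tuple R) (i m n : nat) (nm : (n <= m)%N) :
    koszulH (tuple_exp a m) i -> koszulH (tuple_exp a n) i :=
  homology_map _ (koszul_phi_cycles nm).

Definition weakly_proregular (a : r.-tuple R) :=
  forall i, (1 <= i <= r)%N -> forall n, exists m (nm : (n <= m)%N),
  forall z : koszulH (tuple_exp a m) i, koszulH_phi nm z = 0.
End Koszul.

Section Cech.
Variables (R : comNzRingType) (r : nat) (a : r.-tuple R).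

Definition cech_denom (T : {set 'I_r}) := powers (\prod_(i in T) tnth a i).

Definition cech := @dprodm R {set 'I_r} (fun T => loc (cech_denom T) R^o).
HB.instance Definition _ := GRing.Lmodule.on cech.

Fact cech_denom_sub (T : {set 'I_r}) (i : 'I_r) (s : R) :
  s \in cech_denom (T :\ i) -> exists c, c * s \in cech_denom T.
Proof.
move=> /asboolP[n ->]; have [iT|iT] := boolP (i \in T).
  exists (tnth a i ^+ n); apply/asboolP; exists n.
  by rewrite (big_setD1 i iT) /= exprMn.
exists 1; apply/asboolP; exists n; rewrite mul1r.
congr (_ ^+ n); apply: eq_bigl => j; rewrite in_setD1.
by have [->|] := eqVneq j i; rewrite ?(negPf iT).
Qed.

Definition cech_d (c : cech) : cech := fun T =>
  \sum_(i in T) (-1) ^+ rank_in i T *: loc_map (@cech_denom_sub T i) (c (T :\ i)).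

Fact cech_d_linear : linear cech_d.
Proof.
move=> b x y; apply: functional_extensionality_dep => T.
rewrite dprodmDE dprodmZE /cech_d scaler_sumr -big_split /=.
apply: eq_bigr => i _; rewrite dprodmDE dprodmZE linearP scalerDr !scalerA.
by rewrite [_ * b]mulrC.
Qed.
HB.instance Definition _ :=
  GRing.isLinear.Build R cech cech _ cech_d cech_d_linear.

Definition cechH (p : nat) :=
  homology cech_d (@in_deg R r (fun T => loc (cech_denom T) R^o) p)
    (@in_deg R r (fun T => loc (cech_denom T) R^o) (p%:Z - 1)).
HB.instance Definition _ p := GRing.Lmodule.on (cechH p).

Definition parameter_seq :=
  [/\ weakly_proregular a,
      exists x : R, x \notin ideal_gen a &
      forall P : prime_idealr R, {subset a <= (P : pred R)} ->
        exists z : loc (prime_compl P) (cechH r), z != 0].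
End Cech.

Definition strong_parameter_seq (R : comNzRingType) (a : seq R) :=
  forall i, (1 <= i <= size a)%N -> parameter_seq (in_tuple (take i a)).

Definition regular_seq (R : comNzRingType) (a : seq R) :=
  (forall i, (i < size a)%N ->
     forall z : modquot (ideal_gen (take i a)), a`_i *: z = 0 -> z = 0) /\
  (exists z : modquot (ideal_gen a), z != 0).

Definition HMCM (R : comNzRingType) :=
  forall a : seq R, strong_parameter_seq a -> regular_seq a.

Section Idealization.
Variables (R : comNzRingType) (N : lmodType R).

Definition idealization := (R * N)%type.
HB.instance Definition _ := GRing.Zmodule.on idealization.

Implicit Types p q : idealization.
Definition idealization_one : idealization := (1, 0).
Definition idealization_mul p q : idealization :=
  (p.1 * q.1, p.1 *: q.2 + q.1 *: p.2).

Fact idealization_mulA : associative idealization_mul.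
Proof.
move=> [a x] [b y] [c z]; congr pair; rewrite /= ?mulrA //.
by rewrite !scalerDr !scalerA addrA [c * a]mulrC [c * b]mulrC.
Qed.
Fact idealization_mulC : commutative idealization_mul.
Proof. by move=> [a x] [b y]; congr pair; rewrite /= (mulrC, addrC). Qed.
Fact idealization_mul1 : left_id idealization_one idealization_mul.
Proof.
by move=> [a x]; congr pair; rewrite /= ?mul1r // scale1r scaler0 addr0.
Qed.
Fact idealization_mulDl : left_distributive idealization_mul +%R.
Proof.
move=> [a x] [b y] [c z]; congr pair; rewrite /= ?mulrDl //.
by rewrite scalerDl scalerDr addrACA.
Qed.
Fact idealization_one_neq0 : idealization_one != 0.
Proof. by rewrite xpair_eqE oner_eq0. Qed.
HB.instance Definition _ := GRing.Zmodule_isComNzRing.Build idealization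
  idealization_mulA idealization_mulC idealization_mul1 idealization_mulDl
  idealization_one_neq0.
End Idealization.

(* k[s, t] is {mpoly k[2]}, with s = 'X_0 and t = 'X_1. *)
Section RingB.
Variable k : fieldType.
Local Notation kst := {mpoly k[2]}.

Lemma mcoeff0M (p q : kst) : (p * q)@_0%MM = p@_0%MM * q@_0%MM.
Proof. exact: (rmorphM (mcoeff 0%MM)). Qed.

Definition idealXY : {pred kst} := ideal_gen [:: 'X_0; 'X_1 : kst].

Lemma idealXYE (p : kst) : (p \in idealXY) = (p@_0%MM == 0).
Proof.
have X0 (i : 'I_2) : ('X_i : kst)@_0%MM = 0.
  by rewrite mcoeffX mnm1_eq0.
apply/idP/eqP => [/asboolP[c ->]|p0].
  by rewrite !big_ord_recr big_ord0 /= add0r mcoeffD !mcoeff0M !X0 !mulr0 addr0.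
rewrite [p]mpolyE big_seq.
have idealD (x y : kst) : x \in idealXY -> y \in idealXY -> x + y \in idealXY.
  exact: (@rpredD _ (ideal_gen [:: 'X_0; 'X_1 : kst])).
have ideal0 : 0 \in idealXY by exact: (rpred0 (ideal_gen [:: 'X_0; 'X_1 : kst])).
apply: (big_ind (fun x => x \in idealXY)) => // m mp.
have m0 : m != 0%MM.
  by apply: contraTneq mp => ->; rewrite mcoeff_msupp p0 eqxx.
have [i mi] : exists i, m i != 0%N.
  apply/existsP; apply: contraNT m0 => /existsPn h.
  by apply/eqP/mnmP => i; rewrite mnm0E; apply/eqP; rewrite -[_ == _]negbK h.
rewrite -(submK (_ : U_(i) <= m)%MM) ?lep1mP // mpolyXD scalerAl.
set q := _ *: _; apply/asboolP.
case: (unliftP 0 i) => [j ->|->]; last first.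
  exists (fun n => if n == 0%N then q else 0).
  by rewrite !big_ord_recr big_ord0 /= add0r mul0r addr0.
exists (fun n => if n == 0%N then 0 else q).
rewrite !big_ord_recr big_ord0 /= add0r mul0r add0r.
by congr (_ * 'X_ _); apply: val_inj; rewrite /= ord1.
Qed.

Fact idealXY_closed : idealr_closed idealXY.
Proof.
split=> [||a x y]; rewrite !idealXYE ?mcoeff0 ?mcoeff1 ?eqxx ?oner_eq0 //.
move=> /eqP x0 /eqP y0.
by rewrite mcoeffD mcoeff0M x0 y0 mulr0 addr0.
Qed.
HB.instance Definition _ := isIdealr.Build kst idealXY idealXY_closed.

Fact idealXY_prime : prime_idealr_closed idealXY.
Proof. by move=> x y; rewrite !idealXYE mcoeff0M mulf_eq0. Qed.
HB.instance Definition _ := isPrimeIdealrClosed.Build kst idealXY idealXY_prime.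

Definition ringD : comNzRingType := locp idealXY.
Definition sD : ringD := to_locp idealXY 'X_0.
Definition tD : ringD := to_locp idealXY 'X_1.
Definition maxD : {pred ringD} := ideal_gen [:: sD; tD].

Definition modM : lmodType ringD :=
  dsum (fun g : {g : ringD | (g != 0) && (g \in maxD)} =>
          modquot (ideal_gen [:: val g])).

Definition ringA : comNzRingType := idealization modM.
Definition idealI : {pred ringA^o} :=
  ideal_gen [:: ((sD, 0) : ringA); ((tD, 0) : ringA)].
HB.instance Definition _ := GRing.SubmodClosed.on idealI.
Definition ringB : comNzRingType := idealization (modquot idealI).
End RingB.

(* Main.v *)
(** In B every element is a unit, is nilpotent, or has a nonzero D-component g in
    m.  The nilpotent ones have zero Cech cohomology; the last ones are not
    weakly proregular, because M contains D/g^(n+1) for every n.  So B has no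
    parameter element and is HMCM for want of strong parameter sequences.

    In B[X] take f = (s, 0) + (t, 0) X.  Since s, t is regular on D, the
    s-power torsion of every D/gD has no t-torsion, so f is regular on A[X],
    whereas f kills (A/I)[X].  Hence every f^n with n >= 1 has annihilator
    (A/I)[X] in B[X], which makes f weakly proregular, and as (A/I)[X] is
    nilpotent 1/f is nonzero in the Cech cohomology at every prime containing f:
    f is a parameter, but a zero divisor. *)
From HB Require Import structures.
From mathcomp Require Import all_boot all_order all_algebra ring.
From mathcomp.classical Require Import boolp.
From mathcomp.multinomials Require Import mpoly.
Require Import Defs.

Set Implicit Arguments.
Unset Strict Implicit.
Unset Printing Implicit Defensive.

Import GRing.Theory.
Import Quotient.
Local Open Scope ring_scope.
Local Open Scope quotient_scope.

(** * Membership in generated ideals, and degenerate localizations *)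

Lemma modquot_pi_eq0 (R : comNzRingType) (N : lmodType R) (S : submodClosed N)
  (x : N) : reflect (modquot_pi S x = 0) (x \in S).
Proof.
have pi0 : modquot_pi S 0 = 0 by exact: (raddf0 \pi_(modquot S)).
by rewrite -[X in X \in _]subr0 -pi0; apply: modquot_eqP.
Qed.

Lemma ideal_gen_mull (R : comNzRingType) (a : seq R) (c x : R) :
  x \in ideal_gen a -> c * x \in ideal_gen a.
Proof. by move=> ax; exact: (@rpredZ R R^o (ideal_gen a) c x ax). Qed.

Lemma mem_ideal_gen0 (R : comNzRingType) (x : R) :
  (x \in ideal_gen [::]) = (x == 0).
Proof.
by apply/asboolP/eqP => [[c ->]|->]; [|exists (fun=> 0)]; rewrite big_ord0.
Qed.

Lemma mem_ideal_gen1 (R : comNzRingType) (f x : R) :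
  reflect (exists c, x = c * f) (x \in ideal_gen [:: f]).
Proof.
apply: (iffP (asboolP _)) => [[c ->]|[c ->]].
  by exists (c 0%N); rewrite big_ord1.
by exists (fun=> c); rewrite big_ord1.
Qed.

Lemma mem_ideal_gen2 (R : comNzRingType) (a b x : R) :
  reflect (exists c d, x = c * a + d * b) (x \in ideal_gen [:: a; b]).
Proof.
apply: (iffP (asboolP _)) => [[c ->]|[c [d ->]]].
  by exists (c 0%N), (c 1%N); rewrite !big_ord_recr big_ord0 /= add0r.
exists (fun i => if i == 0%N then c else d).
by rewrite !big_ord_recr big_ord0 /= add0r.
Qed.

Lemma loc_trivial (R : comNzRingType) (S : mulrClosed R) (N : lmodType R)
  (z : loc S N) : 0 \in S -> z = 0.
Proof.
by move=> S0; have [x [s ->]] := fracP z; apply/frac_eqP; exists 0; rewrite ?scale0r.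
Qed.

Lemma frac_0 (R : comNzRingType) (S : mulrClosed R) (N : lmodType R)
  (s : denom S) : frac (0 : N) s = 0.
Proof. by apply: frac_eq; rewrite !scaler0. Qed.

Lemma set_ord1E (T : {set 'I_1}) : T = if ord0 \in T then [set ord0] else set0.
Proof.
by apply/setP => j; rewrite ord1; case: ifP => hT; rewrite ?inE ?hT.
Qed.

(** * Koszul homology of a single element *)

Section LengthOne.
Variables (R : comNzRingType) (a : 1.-tuple R).
Let f := tnth a ord0.

Local Notation deg := (@in_deg R 1 (fun=> R^o)).

Lemma koszul_d1 n (x : koszul R 1) :
  koszul_d (tuple_exp a n) x set0 = f ^+ n * x [set ord0].
Proof.
rewrite /koszul_d big_mkcond big_ord1 in_set0 /= setU0 /GRing.scale /=.
rewrite tnth_mktuple /rank_in (_ : [set _ in _ | _] = set0) ?cards0 ?expr0 ?mul1r //.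
by apply/setP => j; rewrite !inE.
Qed.

Lemma in_cycles1 n (x : koszul R 1) :
  (x \in cycles (koszul_d (tuple_exp a n)) (deg 1%N)) <->
  x set0 = 0 /\ f ^+ n * x [set ord0] = 0.
Proof.
split=> [/andP[/degP x1 /eqP dx]|[x0 fx]].
  split; first by rewrite x1 ?cards0.
  by rewrite -koszul_d1 dx.
apply/andP; split.
  apply/degP => T; rewrite (set_ord1E T); case: ifP => _ //.
  by rewrite cards1.
apply/eqP/functional_extensionality_dep => T; rewrite (set_ord1E T).
case: ifP => _; first by rewrite /= /koszul_d big_mkcond big_ord1 inE.
by rewrite /= koszul_d1.
Qed.

(** A one-element set has no subset of size 2, so the Koszul complex vanishes in degree 2 and only 0
    is a boundary. *)
Lemma boundaries1 n (x : submodule (cycles (koszul_d (tuple_exp a n)) (deg 1%N))) :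
  (x \in boundaries (deg 2%N)) = (val x [set ord0] == 0).
Proof.
apply/asboolP/eqP => [[y /degP y2 ->]|x1].
  rewrite (_ : y = 0) ?raddf0 //; apply: functional_extensionality_dep => T.
  rewrite y2 // (set_ord1E T); case: ifP; rewrite ?cards0 ?cards1 //.
exists 0; first exact: (rpred0 (deg 2%N)).
rewrite raddf0; apply: functional_extensionality_dep => T.
have /in_cycles1[x0 _] := valP x.
by rewrite (set_ord1E T); case: ifP.
Qed.

(** [H_1] of [f^n] is the annihilator of [f^n], and the transition map from level m to level n is
    multiplication by [f^(m - n)]. *)
Lemma weakly_proregular1 : weakly_proregular a <->
  (forall n, exists2 m, (n <= m)%N &
     forall z : R, f ^+ m * z = 0 -> f ^+ (m - n) * z = 0).
Proof.
have phi1 m n (x : koszul R 1) :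
    koszul_phi a m n x [set ord0] = f ^+ (m - n) * x [set ord0].
  by rewrite /koszul_phi big_set1.
split=> [wpr n|wpr i i1 n].
  have [m [nm h]] := wpr 1%N isT n; exists m => // z fz.
  pose x : koszul R 1 := fun T => if ord0 \in T then z else 0.
  have x_cyc : x \in cycles (koszul_d (tuple_exp a m)) (deg 1%N).
    by apply/in_cycles1; rewrite /x !inE eqxx.
  have := h (modquot_pi _ (Submodule x_cyc)).
  rewrite /koszulH_phi homology_map_pi.
  - move=> /modquot_pi_eq0; rewrite boundaries1 /= => /eqP.
    by rewrite phi1 /x inE eqxx.
  - exact: koszul_phi_deg.
  - exact: koszul_phi_d.
have {i i1} -> : i = 1%N by case: i i1 => [|[]].
have [m nm h] := wpr n; exists m, nm => z.
apply/modquot_pi_eq0; rewrite boundaries1 /=; apply/eqP; rewrite phi1.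
by apply: h; have /in_cycles1[] := valP (repr z).
Qed.
End LengthOne.

(** * Čech cohomology of a single element *)

Section CechOne.
Variables (R : comNzRingType) (a : 1.-tuple R).
Let f := tnth a ord0.

(** Once [f] is nilpotent, 0 is a power of [f], so the degree 1 term [R_f] is already zero. *)
Lemma cechH1_nilpotent N (z : cechH a 1) : f ^+ N = 0 -> z = 0.
Proof.
move=> fN; rewrite -(modquot_piK z); apply/modquot_pi_eq0/asboolP.
exists 0; first exact: (rpred0 (@in_deg R 1 (fun T => loc (cech_denom a T) R^o) _)).
have /andP[/degP z1 _] := valP (repr z).
rewrite raddf0; apply: functional_extensionality_dep => T.
have [/eqP T1|T1] := boolP (#|T|%:Z == 1); last by rewrite z1.
apply: loc_trivial; apply/asboolP; exists N.
have /cards1P[j ->] : #|T| == 1%N by rewrite -eqz_nat T1.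
by rewrite big_set1 (ord1 j) fN.
Qed.

(** The cohomology is [R_f] modulo the image of [R]. If [u] kills the class of [1/f], then
    [u/f = b/1] in [R_f], that is, [f^N (u - b f) = 0] for some [N]. The hypothesis puts every such
    [u] in [P], so the class survives localization at [P]. *)
Lemma cechH1_neq0 (P : prime_idealr R) :
  (forall u b N, f ^+ N * (u - b * f) = 0 -> u \in (P : pred R)) ->
  exists z : loc (prime_compl P) (cechH a 1), z != 0.
Proof.
move=> fP.
have prodP (T : {set 'I_1}) : \prod_(i in T) tnth a i \in cech_denom a T.
  by apply/asboolP; exists 1%N.
(* The cochain [1/f]: the denominator is the product over [T], which is [f] on the full set, and the
   component at the empty set is zero. *)
pose c : cech a := fun T =>
  frac (S := cech_denom a T) (N := R^o)
    (if ord0 \in T then 1 else 0) (exist (fun x => x \in cech_denom a T) _ (prodP T)).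
have c0 (T : {set 'I_1}) : ord0 \notin T -> c T = 0.
  by move=> /negPf T0; rewrite /c T0 frac_0.
have c_cyc : c \in cycles (cech_d (a := a))
    (@in_deg R 1 (fun T => loc (cech_denom a T) R^o) 1%N).
  apply/andP; split.
    apply/degP => T T1; apply: c0; apply: contra T1 => T0.
    by rewrite (set_ord1E T) T0 cards1.
  apply/eqP/functional_extensionality_dep => T /=.
  apply: big1 => i _; rewrite c0 ?raddf0 ?scaler0 //.
  by rewrite (ord1 i) !inE eqxx.
pose z : cechH a 1 := modquot_pi _ (Submodule c_cyc).
exists (frac z (denom1 _)); apply/eqP => /frac_eqP[u Pu] /=.
rewrite scale1r !scaler0.
rewrite -[u *: z]/(modquot_scale u z) modquot_piZ.
move=> /modquot_pi_eq0/asboolP[y _] /(congr1 (fun x : cech a => x [set ord0])) /=.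
have -> : cech_d y [set ord0] =
    loc_map (@cech_denom_sub R 1 a [set ord0] ord0) (y ([set ord0] :\ ord0)).
  rewrite /cech_d [LHS]big_set1.
  have -> : rank_in ord0 [set @ord0 0] = 0%N.
    apply/eqP; rewrite cards_eq0; apply/eqP/setP => j.
    by rewrite !inE (ord1 j) ltnn andbF.
  by rewrite expr0 scale1r.
rewrite dprodmZE frac_scaleE.
have [b [[s Ss] ->]] := fracP (y ([set ord0] :\ ord0)).
(* At the empty set the denominators are powers of an empty product, so the component of [y] there
   is [b/1]. *)
have s1 : s = 1.
  have /asboolP[n ->] := Ss; rewrite big1 ?expr1n // => i.
  by rewrite (ord1 i) !inE eqxx.
have S's : 1 * sval (exist (fun s => s \in cech_denom a ([set ord0] :\ ord0)) s Ss)
    \in cech_denom a [set ord0].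
  by rewrite /= s1 mulr1; exact: rpred1.
rewrite (loc_map_frac _ _ S's) => /frac_eqP[v /asboolP[N ->]] /=.
rewrite s1 !mulr1 inE eqxx !big_set1 /GRing.scale /= !mul1r mulr1 => e.
move: Pu; rewrite -topredE /= /prime_compl (fP u b N) //.
by rewrite mulrBr e [b * _]mulrC subrr.
Qed.
End CechOne.

(** * Which elements can be parameters *)

Section ParameterElement.
Variables (R : comNzRingType) (b : R).

Lemma unit_not_parameter c : b * c = 1 -> ~ parameter_seq [tuple b].
Proof.
move=> bc [_ [x x_notin] _]; case/negP: x_notin; apply/mem_ideal_gen1.
by exists (x * c); rewrite -mulrA [c * b]mulrC bc mulr1.
Qed.

(** Condition (3) has content only at an actual prime, hence the argument [P]; a nilpotent element
    lies in every prime, and its Čech cohomology vanishes. *)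
Lemma nilpotent_not_parameter (P : prime_idealr R) n :
  b ^+ n = 0 -> ~ parameter_seq [tuple b].
Proof.
move=> bn [_ _ cech_neq0].
have bP : {subset [tuple b] <= (P : pred R)}.
  move=> x; rewrite inE => /eqP ->; apply: contraT => Pb.
  have : b ^+ n \in prime_compl P by apply: rpredX.
  by rewrite bn (negPf (prime_compl0 P)).
have [z /eqP[]] := cech_neq0 P bP.
have [c [d ->]] := fracP z; rewrite (_ : c = 0) ?frac_0 //.
by apply: (@cechH1_nilpotent _ _ n).
Qed.

Lemma parameter_torsion n : parameter_seq [tuple b] ->
  exists2 m, (n <= m)%N & forall z : R, b ^+ m * z = 0 -> b ^+ (m - n) * z = 0.
Proof. by move=> [/weakly_proregular1]. Qed.
End ParameterElement.

(** The first term of a nonempty strong parameter sequence is itself a parameter. Only the empty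
    sequence remains, and it is regular because 1 is nonzero. *)
Lemma HMCM_no_parameter (R : comNzRingType) :
  (forall b : R, ~ parameter_seq [tuple b]) -> HMCM R.
Proof.
move=> no_param [_|b a /(_ 1%N isT)]; last first.
  have -> : take 1 (b :: a) = [:: b] by rewrite /= take0.
  have -> : in_tuple [:: b] = [tuple b] :> 1.-tuple R by apply: val_inj.
  by move=> /no_param.
split=> [[]//|]; exists (modquot_pi _ 1); apply/eqP => /modquot_pi_eq0.
by rewrite mem_ideal_gen0 oner_eq0.
Qed.

(** * Idealizations and polynomials over them *)

Lemma idealization_sqr0 (R : comNzRingType) (N : lmodType R)
  (x y : idealization N) : x.1 = 0 -> y.1 = 0 -> x * y = 0.
Proof.
case: x y => [a u] [b v] /= -> ->.
by congr pair; rewrite /= ?mul0r // !scale0r addr0.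
Qed.

Lemma idealization_unit (R : comNzRingType) (N : lmodType R)
  (x : idealization N) c : x.1 * c = 1 -> exists y, x * y = 1.
Proof.
(* With [a c = 1], the inverse of [(a, u)] is [(c, - c^2 u)]. *)
case: x => [a u] /= ac; exists (c, - (c *: (c *: u))).
by congr pair => //=; rewrite scalerN [a *: _]scalerA ac scale1r addrC subrr.
Qed.

Section IdealizationFst.
Variables (R : comNzRingType) (N : lmodType R).

Definition idealization_fst (x : idealization N) : R := x.1.

Fact idealization_fst_zmod_morphism : zmod_morphism idealization_fst.
Proof. by []. Qed.
Fact idealization_fst_monoid_morphism : monoid_morphism idealization_fst.
Proof. by []. Qed.
HB.instance Definition _ := GRing.isZmodMorphism.Build (idealization N) R
  idealization_fst idealization_fst_zmod_morphism.
HB.instance Definition _ := GRing.isMonoidMorphism.Build (idealization N) R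
  idealization_fst idealization_fst_monoid_morphism.

Lemma map_fst_eq0_coef (p : {poly idealization N}) i :
  map_poly idealization_fst p = 0 -> p`_i = (0, (p`_i).2).
Proof.
move=> /polyP/(_ i); rewrite coef_map coef0 /idealization_fst.
by case: (p`_i) => x y /= ->.
Qed.

Lemma map_fst_eq0_mul (p q : {poly idealization N}) :
  map_poly idealization_fst p = 0 -> map_poly idealization_fst q = 0 -> p * q = 0.
Proof.
move=> p0 q0; apply/polyP => i; rewrite coefM coef0 big1 // => j _.
by apply: idealization_sqr0; rewrite map_fst_eq0_coef.
Qed.
End IdealizationFst.

(* Downward induction on i: once p_(i+1) = 0, the equation at X^(i+1) kills p_i
   by t, while a power of s kills every p_i by the equations below it. *)
Lemma linear_poly_regular (R : comNzRingType) (s t : R) :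
  (forall n x, s ^+ n * x = 0 -> t * x = 0 -> x = 0) ->
  forall p : {poly R}, (s%:P + t%:P * 'X) * p = 0 -> p = 0.
Proof.
move=> st_reg p /polyP fp0.
have fp i : s * p`_i + (if i is j.+1 then t * p`_j else 0) = 0.
  have := fp0 i; rewrite coef0 mulrDl coefD coefCM -mulrA coefCM ['X * _]mulrC coefMX.
  by case: i => //=; rewrite mulr0.
have s_tors i : s ^+ i.+1 * p`_i = 0.
  elim: i => [|i IHi]; first by rewrite expr1 -[LHS]addr0; exact: (fp 0%N).
  have -> : s ^+ i.+2 * p`_i.+1 =
      s ^+ i.+1 * (s * p`_i.+1 + t * p`_i) - t * (s ^+ i.+1 * p`_i).
    by rewrite !exprS; ring.
  by rewrite (fp i.+1) IHi !mulr0 subr0.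
suff p0 m i : (size p <= i + m)%N -> p`_i = 0.
  by apply/polyP => i; rewrite coef0 (p0 (size p)) ?leq_addl.
elim: m i => [|m IHm] i; first by rewrite addn0 => /(nth_default 0).
rewrite addnS -addSn => /IHm pi0; apply: (st_reg i.+1) (s_tors i) _.
by have := fp i.+1; rewrite pi0 mulr0 add0r.
Qed.

(** The kernel of [phi], which forgets the second components, has square zero and is killed by
    [f = s + t X]. Since [phi f] is a non-zero-divisor, each [f^n] with n positive has exactly this
    kernel as annihilator. *)
Lemma not_HMCM_poly_idealization (R : comNzRingType) (s t : R)
  (J : submodClosed R^o) : J =i ideal_gen [:: s; t] -> 1 \notin J ->
  (forall n x, s ^+ n * x = 0 -> t * x = 0 -> x = 0) ->
  ~ HMCM {poly idealization (modquot J)}.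
Proof.
set B := idealization _ => J_gen J1 st_reg.
pose phi := map_poly (@idealization_fst R (modquot J)).
pose f : {poly B} := ((s, 0) : B)%:P + ((t, 0) : B)%:P * 'X.
have phif : phi f = s%:P + t%:P * 'X.
  by rewrite /phi rmorphD rmorphM /= !map_polyC map_polyX.
have phi_reg w n : f ^+ n * w = 0 -> phi w = 0.
  elim: n w => [|n IHn] w; first by rewrite expr0 mul1r => ->; rewrite /phi rmorph0.
  rewrite exprSr -mulrA => /IHn; rewrite /phi rmorphM /= -/phi phif.
  exact: linear_poly_regular.
have sJ : s \in J.
  by rewrite J_gen; apply/mem_ideal_gen2; exists 1, 0; rewrite mul1r mul0r addr0.
have tJ : t \in J.
  by rewrite J_gen; apply/mem_ideal_gen2; exists 0, 1; rewrite mul1r mul0r add0r.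
have J_annihil c (v : modquot J) : c \in J -> ((c, 0) : B) * (0, v) = 0.
  move=> Jc; congr pair; rewrite /= ?mulr0 // scale0r addr0.
  rewrite -(modquot_piK v) [LHS]modquot_piZ; apply/modquot_pi_eq0.
  have -> : c *: repr v = (repr v : R) *: (c : R^o) by exact: mulrC.
  exact: (rpredZ (repr v : R) Jc).
have f_annihil w : phi w = 0 -> f * w = 0.
  move=> w0; apply/polyP => i.
  rewrite coef0 mulrDl coefD coefCM -mulrA coefCM ['X * _]mulrC coefMX.
  rewrite [in X in X + _](map_fst_eq0_coef _ w0) J_annihil // add0r.
  by case: i => [|i] /=; rewrite ?mulr0 // (map_fst_eq0_coef _ w0) J_annihil.
move=> /(_ [:: f])[].
  move=> [|[|i]] //= _; split.
  (* With m = n + 1 the transition map is multiplication by [f] itself, which kills the annihilator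
     of [f^(n+1)]. *)
  - apply/weakly_proregular1 => n; exists n.+1; first exact: leqnSn.
    move=> w /phi_reg /f_annihil fw; rewrite subSn // subnn expr1.
    exact: fw.
  (* The constant coefficient of [phi (c * f)] is a multiple of [s], hence in [J], while 1 is
     not. *)
  - exists 1; apply/negP => /mem_ideal_gen1[c /(congr1 phi)].
    rewrite /phi rmorph1 rmorphM /= -/phi phif => /polyP/(_ 0%N).
    rewrite coef1 mulrDr coefD mulrA coefMX addr0 coefMC => e.
    case/negP: J1; rewrite [1]e; exact: (rpredZ _ sJ).
  (* Here [u - b f] lies in the kernel of [phi], so its square is 0 and it belongs to [P]; as [f]
     does too, so does [u]. *)
  - move=> P Pf; apply: cechH1_neq0 => u b N /phi_reg w0.
    have fP : f \in (P : pred _) by apply: Pf; rewrite inE.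
    have : (u - b * f) * (u - b * f) \in (P : pred _).
      by rewrite (map_fst_eq0_mul w0 w0) idealr0.
    rewrite prime_idealrM orbb => wP.
    rewrite -[u](subrK (b * f)); apply: rpredD => //.
    exact: idealMr.
move=> /(_ 0%N isT) f_reg _.
(* The class of 1 in [R/J] is nonzero and killed by [f], so [f] is a zero divisor. *)
pose e : {poly B} := ((0, modquot_pi J 1) : B)%:P.
have fe : f * e = 0.
  by apply: f_annihil; rewrite /phi /e map_polyC.
have : modquot_pi (ideal_gen (take 0 [:: f])) e = 0.
  apply: f_reg; rewrite [LHS]modquot_piZ; apply/modquot_pi_eq0.
  by rewrite mem_ideal_gen0; apply/eqP; exact: fe.
move=> /modquot_pi_eq0; rewrite mem_ideal_gen0 polyC_eq0 => /eqP[] /modquot_pi_eq0.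
exact/negP.
Qed.

(** * Torsion in direct sums of cyclic modules *)

(* Integrality is a hypothesis because [locp] only has a [comNzRingType]
   structure. *)
Section DirectSumOfCyclics.
Variables (D : comNzRingType) (J : eqType) (g : J -> D).
Hypothesis D_domain : forall x y : D, (x * y == 0) = (x == 0) || (y == 0).
Local Notation M := (dsum (fun j => modquot (ideal_gen [:: g j]))).

Lemma domain_mulfI (x : D) : x != 0 -> injective ( *%R x).
Proof.
move=> x0 y z /eqP; rewrite -subr_eq0 -mulrBr D_domain (negPf x0) /=.
by rewrite subr_eq0 => /eqP.
Qed.

Lemma domain_expf_neq0 (x : D) n : x != 0 -> x ^+ n != 0.
Proof.
move=> x0; elim: n => [|n IHn]; first by rewrite expr0 oner_neq0.
by rewrite exprS D_domain negb_or x0.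
Qed.

Section Torsion.
Variables s t : D.
Hypothesis s_neq0 : s != 0.
Hypothesis s_dvd : forall x y, t * x = s * y -> exists z, x = s * z.

(** One factor [s] is split off and cancelled at a time. *)
Lemma exp_dvd n (x y : D) : t * x = s ^+ n * y -> exists z, x = s ^+ n * z.
Proof.
elim: n x y => [|n IHn] x y; first by exists x; rewrite expr0 mul1r.
rewrite exprS -mulrA => e; have [x' ex] := s_dvd e; move: e.
rewrite ex mulrCA => /(domain_mulfI s_neq0)/IHn[z ->].
by exists z; rewrite mulrA.
Qed.

(** In one component let [t x = b g] and [s^n x = c g]. Cancelling [g] gives [t c = s^n b], so
    [c = s^n c'] by [exp_dvd], and cancelling [s^n] leaves [x = c' g]. *)
Lemma dsum_torsion n (u : M) :
  (forall j, g j != 0) -> s ^+ n *: u = 0 -> t *: u = 0 -> u = 0.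
Proof.
move=> g_neq0 su tu; apply/val_inj/functional_extensionality_dep => j /=.
have := congr1 (fun u : M => val u j) su.
have := congr1 (fun u : M => val u j) tu.
rewrite /= !dprodmZE -(modquot_piK (val u j)); move: (repr _) => x.
rewrite [LHS]modquot_piZ => /modquot_pi_eq0/mem_ideal_gen1[b].
rewrite /GRing.scale /= => eb.
rewrite [LHS]modquot_piZ => /modquot_pi_eq0/mem_ideal_gen1[c].
rewrite /GRing.scale /= => ec.
have [c' e] : exists c', c = s ^+ n * c'.
  apply: (@exp_dvd n c b); apply: (domain_mulfI (g_neq0 j)).
  have -> : g j * (t * c) = t * (c * g j) by ring.
  by rewrite -ec mulrCA eb; ring.
apply/modquot_pi_eq0/mem_ideal_gen1; exists c'.
by apply: (domain_mulfI (domain_expf_neq0 n s_neq0)); rewrite ec e mulrA.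
Qed.
End Torsion.

(** The power [x^(n+1)] is one of the [g j], and [w] is the generator of that summand. If [x^n w]
    were 0, then [x^n = d x^(n+1)], so 1 would be a multiple of [x]. *)
Lemma dsum_unbounded (a : seq D) : 1 \notin ideal_gen a ->
  (forall x : D, x != 0 -> x \in ideal_gen a -> exists j, g j = x) ->
  forall (x : D) n, x != 0 -> x \in ideal_gen a ->
  exists w : M, x ^+ n.+1 *: w = 0 /\ x ^+ n *: w != 0.
Proof.
move=> a1 g_sur x n x_neq0 ax.
have ax_exp : x ^+ n.+1 \in ideal_gen a by rewrite exprSr; apply: ideal_gen_mull.
have [j gj] := g_sur _ (domain_expf_neq0 n.+1 x_neq0) ax_exp.
pose w : dprodm (fun j => modquot (ideal_gen [:: g j])) :=
  fun i => modquot_pi _ ((i == j)%:R : D^o).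
have w_fin : w \in finsupp (V := fun j => modquot (ideal_gen [:: g j])).
  apply/asboolP; exists [:: j] => i; rewrite inE /w.
  by case: (i == j) => //= /eqP[]; apply/modquot_pi_eq0; exact: rpred0.
exists (Submodule w_fin); split.
  apply/val_inj/functional_extensionality_dep => i /=.
  rewrite dprodmZE /w [LHS]modquot_piZ; apply/modquot_pi_eq0/mem_ideal_gen1.
  case: eqVneq => [->|_]; last by exists 0; rewrite mul0r [LHS]mulr0.
  by exists 1; rewrite mul1r gj [LHS]mulr1.
apply/eqP => /(congr1 (fun u : M => val u j)) /=.
rewrite dprodmZE /w eqxx [LHS]modquot_piZ => /modquot_pi_eq0/mem_ideal_gen1[d].
rewrite [LHS]mulr1 gj exprSr mulrCA -[LHS]mulr1.
move=> /(domain_mulfI (domain_expf_neq0 n x_neq0)) e.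
case/negP: a1; rewrite (e : 1 = d * x); exact: ideal_gen_mull.
Qed.
End DirectSumOfCyclics.

(** * The ring [A * (A/I)] over a domain *)

Section DoubleIdealization.
Variables (D : comNzRingType) (s t : D) (M : lmodType D).
Local Notation A := (idealization M).
Variable I : submodClosed A^o.
Local Notation B := (idealization (modquot I)).
Local Notation m := (ideal_gen [:: s; t]).
Hypothesis D_domain : forall x y : D, (x * y == 0) = (x == 0) || (y == 0).
Hypothesis I_gen : I =i ideal_gen [:: ((s, 0) : A); ((t, 0) : A)].
Hypothesis m1 : 1 \notin m.

Lemma fst_mem_ideal (x : A) : x \in I -> x.1 \in m.
Proof.
rewrite I_gen => /mem_ideal_gen2[c [d ->]]; apply/mem_ideal_gen2.
by exists c.1, d.1.
Qed.

(** Thus [mM] lies in [I] and annihilates [A/I]. *)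
Lemma scale_mem_ideal (x : D) (w : M) : x \in m -> ((0, x *: w) : A) \in I.
Proof.
move=> /mem_ideal_gen2[c [d ->]]; rewrite I_gen; apply/mem_ideal_gen2.
exists (0, c *: w), (0, d *: w); congr pair; rewrite /= ?mul0r ?addr0 //.
by rewrite !scale0r !add0r scalerDl !scalerA ![_ * c]mulrC ![_ * d]mulrC.
Qed.

Section HMCM.
Hypothesis m_unit : forall x : D, x \notin m -> exists y, x * y = 1.
Hypothesis M_unbounded : forall (x : D) n, x != 0 -> x \in m ->
  exists w : M, x ^+ n.+1 *: w = 0 /\ x ^+ n *: w != 0.

(** The nilradical of [B], prime because the quotient is the domain [D]; it is the prime at which
    nilpotent elements are tested. *)
Definition nilideal : {pred B} := fun b => b.1.1 == 0.

Fact nilideal_idealr : idealr_closed nilideal.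
Proof.
split; rewrite -?topredE /= /nilideal ?eqxx ?oner_neq0 //.
move=> a x y /eqP x0 /eqP y0; rewrite -topredE /= /nilideal /=.
by rewrite x0 y0 mulr0 addr0.
Qed.
HB.instance Definition _ := isIdealr.Build B nilideal nilideal_idealr.

Fact nilideal_prime : prime_idealr_closed nilideal.
Proof. by move=> x y; rewrite -!topredE /= /nilideal /= D_domain. Qed.
HB.instance Definition _ := isPrimeIdealrClosed.Build B nilideal nilideal_prime.

(** The factor [b.1.1] puts the vector in [I], so multiplying it by [b] produces no component in
    [A/I] and [b] acts as the scalar [b.1.1]. *)
Lemma exp_mul_torsion (b : B) n (w : M) : b.1.1 \in m ->
  b ^+ n * ((0, b.1.1 *: w), 0) = ((0, b.1.1 ^+ n *: (b.1.1 *: w)), 0).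
Proof.
case: b => [[x u] v] /= xm; elim: n w => [|n IHn] w.
  by rewrite !expr0 mul1r scale1r.
rewrite exprSr -mulrA.
have -> : ((x, u, v) : B) * ((0, x *: w), 0) = ((0, x *: (x *: w)), 0).
  congr pair => /=.
    by congr pair; rewrite /= ?mulr0 // scale0r addr0.
  rewrite scaler0 add0r -(modquot_piK v) [LHS]modquot_piZ.
  apply/modquot_pi_eq0.
  have -> : ((0, x *: w) : A) *: repr v = (repr v : A) *: ((0, x *: w) : A^o).
    exact: mulrC.
  exact: (rpredZ _ (scale_mem_ideal w xm)).
by rewrite IHn exprSr scalerA.
Qed.

Lemma parameter_seq1_false (b : B) : ~ parameter_seq [tuple b].
Proof.
move=> b_param.
have [xm|/m_unit[y xy]] := boolP (b.1.1 \in m); last first.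
  have [a' ba'] : exists a' : A, b.1 * a' = 1.
    exact: (@idealization_unit D M b.1 y xy).
  have [b' bb'] : exists b', b * b' = 1.
    exact: (@idealization_unit A _ b a' ba').
  exact: (unit_not_parameter bb').
have [x0|x_neq0] := eqVneq b.1.1 0.
  (* The square of [b] has zero component in [A], so its fourth power is 0. *)
  apply: (@nilpotent_not_parameter _ b nilideal (2 * 2)%N) b_param.
  have bb : (b ^+ 2).1 = 0 by apply: (@idealization_sqr0 D M).
  by rewrite exprM; apply: idealization_sqr0.
(* At level 1, [b^n z = 0] would force [b^(n-1) z = 0]. With [x = b.1.1], this fails for [z = x w],
   where [x^(n+1)] kills [w] but [x^n] does not. *)
have [n n_gt0 bn] := parameter_torsion 1 b_param.
have [w [xw0 /eqP[]]] := M_unbounded n x_neq0 xm.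
have /bn : b ^+ n * ((0, b.1.1 *: w), 0) = 0.
  by rewrite exp_mul_torsion // scalerA -exprSr xw0.
rewrite exp_mul_torsion // scalerA -exprSr subn1 prednK //.
by move=> /(congr1 (fun z : B => z.1.2)).
Qed.

Lemma HMCM_double_idealization : HMCM B.
Proof. exact: HMCM_no_parameter parameter_seq1_false. Qed.
End HMCM.

Section NotHMCM.
Hypothesis t_neq0 : t != 0.
Hypothesis M_torsion : forall n (u : M), s ^+ n *: u = 0 -> t *: u = 0 -> u = 0.

Lemma idealization_exp (d : D) n : ((d, 0) : A) ^+ n = (d ^+ n, 0).
Proof.
elim: n => [|n IHn]; first by rewrite !expr0.
by rewrite !exprS IHn; congr pair; rewrite /= !scaler0 addr0.
Qed.

Lemma idealization_torsion n (x : A) :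
  ((s, 0) : A) ^+ n * x = 0 -> ((t, 0) : A) * x = 0 -> x = 0.
Proof.
case: x => d u; rewrite idealization_exp => /(congr1 snd) /= su tx.
have /eqP := congr1 fst tx; have := congr1 snd tx; move: su => /=.
rewrite !scaler0 !addr0 D_domain (negPf t_neq0) => su tu /eqP ->.
by rewrite (M_torsion su tu).
Qed.

Lemma not_HMCM_poly_double_idealization : ~ HMCM {poly B}.
Proof.
apply: (not_HMCM_poly_idealization I_gen); last exact: idealization_torsion.
by apply: contra m1 => /fst_mem_ideal.
Qed.
End NotHMCM.
End DoubleIdealization.

(** * Variables are prime in polynomial rings *)

Section DivisibilityByVariable.
Variables (R : idomainType) (n : nat) (i : 'I_n).
Implicit Types p q : {mpoly R[n]}.

Let kill := [tuple if j == i then (0 : {mpoly R[n]}) else 'X_j | j < n].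

(** Substituting 0 for ['X_i] changes any polynomial by a multiple of ['X_i], as is checked on
    monomials. *)
Lemma mpolyX_dvdP p :
  reflect (exists q, p = 'X_i * q) (p \mPo kill == 0).
Proof.
apply: (iffP eqP) => [p0|[q ->]]; last first.
  by rewrite rmorphM /= comp_mpolyXU -tnth_nth tnth_mktuple eqxx mul0r.
suff [q e] : exists q, p - (p \mPo kill) = 'X_i * q by exists q; rewrite -e p0 subr0.
elim/mpolyind: p {p0} => [|c m p _ _ [q e]].
  by exists 0; rewrite comp_mpoly0 subr0 mulr0.
suff [r er] : exists r, 'X_[m] - ('X_[m] \mPo kill) = 'X_i * r.
  exists (c *: r + q).
  by rewrite comp_mpolyD comp_mpolyZ opprD addrACA e -scalerBr er mulrDr scalerAr.
rewrite comp_mpolyX [X in X - _]mpolyXE_id (bigD1 i) //= [X in _ - X](bigD1 i) //=.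
rewrite tnth_mktuple eqxx.
set u := \prod_(j < n | _) _; set v := \prod_(j < n | _) _.
have -> : v = u by apply: eq_bigr => j /negPf ji; rewrite tnth_mktuple ji.
rewrite -/u; case: (m i) => [|d]; first by exists 0; rewrite !expr0 subrr mulr0.
by exists ('X_i ^+ d * u); rewrite expr0n mul0r subr0 exprS mulrA.
Qed.

(** The multiples of ['X_i] are the kernel of a ring morphism into a domain. *)
Lemma mpolyX_prime p q :
  (exists r, p * q = 'X_i * r) -> (exists r, p = 'X_i * r) \/ exists r, q = 'X_i * r.
Proof.
move=> /mpolyX_dvdP; rewrite rmorphM /= mulf_eq0.
by case/orP => /mpolyX_dvdP; [left | right].
Qed.
End DivisibilityByVariable.

(** * Localization of a domain at a prime with two generators *)

Section LocalDomain.
Variables (R : idomainType) (P : prime_idealr R).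
Local Notation D := (locp P).

Lemma locp_mulE (x y : R^o) (q r : denom (prime_compl P)) :
  (frac x q : D) * (frac y r : D) = frac ((x : R) * y : R^o) (denomM q r).
Proof. exact: locp_mul_frac. Qed.

Lemma locp_frac_eq (x y : R^o) (q r : denom (prime_compl P)) :
  frac x q = frac y r <-> sval r * x = sval q * y :> R.
Proof.
split=> [/frac_eqP[u Pu]|e]; last by apply: frac_eq; exact: e.
apply: mulfI; apply: contraTneq Pu => ->; exact: prime_compl0.
Qed.

Lemma locp_frac_eq0 (x : R^o) (q : denom (prime_compl P)) :
  frac x q = 0 <-> x = 0 :> R.
Proof.
rewrite [0]frac0E locp_frac_eq /= mul1r mulr0; exact: iff_refl.
Qed.

Lemma locp_mulf_eq0 (x y : D) : (x * y == 0) = (x == 0) || (y == 0).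
Proof.
apply/eqP/orP => [|[]/eqP ->]; rewrite ?mul0r ?mulr0 //.
have [p [q ->]] := fracP x; have [p' [q' ->]] := fracP y.
rewrite locp_mulE => /locp_frac_eq0/eqP; rewrite mulf_eq0 => /orP[]/eqP h.
  by left; apply/eqP/locp_frac_eq0.
by right; apply/eqP/locp_frac_eq0.
Qed.

Lemma to_locp_neq0 (a : R) : a != 0 -> to_locp P a != 0.
Proof. by apply: contra_neq => /locp_frac_eq0. Qed.

Lemma locp_unit (x : R^o) (q : denom (prime_compl P)) :
  (x : R) \notin (P : pred R) -> exists y : D, (frac x q : D) * y = 1.
Proof.
move=> Px; exists (frac (sval q : R^o) (exist (fun p => p \in prime_compl P) _ Px)).
by rewrite locp_mulE; apply/locp_frac_eq; rewrite /= mul1r mulr1 mulrC.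
Qed.

Section TwoGenerators.
Variables a b : R.
Hypothesis genP : forall p, reflect (exists c d, p = c * a + d * b) (p \in (P : pred R)).

Lemma mem_locp_ideal (x : R^o) (q : denom (prime_compl P)) :
  ((frac x q : D) \in ideal_gen [:: to_locp P a; to_locp P b]) =
  ((x : R) \in (P : pred R)).
Proof.
apply/mem_ideal_gen2/genP => [[y [z]]|[c [d ->]]]; last first.
  exists (frac (c : R^o) q), (frac (d : R^o) q).
  rewrite !locp_mulE [RHS]frac_addE; apply/locp_frac_eq.
  by rewrite /= /GRing.scale /=; ring.
have [c [u ->]] := fracP y; have [d [v ->]] := fracP z.
rewrite !locp_mulE frac_addE => /locp_frac_eq; rewrite /= /GRing.scale /= !mulr1 => e.
(* Clearing denominators puts a multiple of [x] in [P]; the factors [u] and [v] lie outside [P] and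
   can be removed. *)
have : sval u * sval v * x \in (P : pred R).
  apply/genP; exists (sval q * sval v * c), (sval q * sval u * d).
  by rewrite e; ring.
have den_notin (w : denom (prime_compl P)) : (sval w \in (P : pred R)) = false.
  exact: negPf (valP w).
by rewrite !prime_idealrM !den_notin => /genP.
Qed.

Lemma locp_ideal_unit (x : D) :
  x \notin ideal_gen [:: to_locp P a; to_locp P b] -> exists y, x * y = 1.
Proof.
have [p [q ->]] := fracP x; rewrite mem_locp_ideal; exact: locp_unit.
Qed.

Lemma locp_ideal1 : (1 : D) \notin ideal_gen [:: to_locp P a; to_locp P b].
Proof. by rewrite mem_locp_ideal idealr1. Qed.

Hypothesis a_prime : forall p q, (exists r, p * q = a * r) ->
  (exists r, p = a * r) \/ exists r, q = a * r.
Hypothesis b_ndvd : ~ exists r, b = a * r.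

(** After clearing denominators, [a] divides [q' b p]. It divides neither [b] nor [q'], the latter
    being outside [P], so it divides [p]. *)
Lemma to_locp_dvd (x y : D) :
  to_locp P b * x = to_locp P a * y -> exists z, x = to_locp P a * z.
Proof.
have [p [q ->]] := fracP x; have [p' [q' ->]] := fracP y.
rewrite !locp_mulE => /locp_frac_eq /=; rewrite !mul1r => e.
have /a_prime[/a_prime[[r er]|//]|[r er]] : exists r, (sval q' * b) * p = a * r.
- by exists (sval q * p'); rewrite -mulrA e mulrCA.
- have /negP[] := valP q'; apply/genP; exists r, 0.
  by rewrite mul0r addr0 mulrC.
- exists (frac (r : R^o) q).
  by rewrite locp_mulE er; apply/locp_frac_eq; rewrite /= mul1r.
Qed.
End TwoGenerators.
End LocalDomain.

(** * The plane localized at the origin *)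

Section Plane.
Variable k : fieldType.
Local Notation kst := {mpoly k[2]}.
Local Notation D := (ringD k).
Local Notation s := (sD k).
Local Notation t := (tD k).

Lemma idealXYP (p : kst) :
  reflect (exists a b, p = a * 'X_0 + b * 'X_1) (p \in @idealXY k).
Proof. exact: mem_ideal_gen2. Qed.

Lemma mpolyX_neq0 (i : 'I_2) : 'X_i != 0 :> kst.
Proof.
by apply/eqP => /(congr1 (mcoeff U_(i)))/eqP; rewrite mcoeff0 mcoeffX eqxx oner_eq0.
Qed.

Lemma sD_neq0 : s != 0.
Proof. exact: (to_locp_neq0 _ (mpolyX_neq0 _)). Qed.

Lemma tD_neq0 : t != 0.
Proof. exact: (to_locp_neq0 _ (mpolyX_neq0 _)). Qed.

Lemma maxD_unit (x : D) : x \notin @maxD k -> exists y, x * y = 1.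
Proof. exact: (locp_ideal_unit idealXYP). Qed.

Lemma maxD1 : 1 \notin @maxD k.
Proof. exact: (locp_ideal1 idealXYP). Qed.

Lemma sD_dvd (x y : D) : t * x = s * y -> exists z, x = s * z.
Proof.
apply: (to_locp_dvd idealXYP); first exact: mpolyX_prime.
(* Setting ['X_0] to 0 leaves ['X_1] unchanged and nonzero, so ['X_0] does not divide it. *)
move=> /mpolyX_dvdP; rewrite comp_mpolyXU -tnth_nth tnth_mktuple /=.
by rewrite (negPf (mpolyX_neq0 _)).
Qed.

Lemma ringD_domain (x y : D) : (x * y == 0) = (x == 0) || (y == 0).
Proof. exact: locp_mulf_eq0. Qed.

Lemma modM_torsion n (u : modM k) : s ^+ n *: u = 0 -> t *: u = 0 -> u = 0.
Proof.
apply: (dsum_torsion ringD_domain sD_neq0 sD_dvd) => g.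
by case/andP: (valP g).
Qed.

Lemma modM_unbounded (x : D) n : x != 0 -> x \in @maxD k ->
  exists w : modM k, x ^+ n.+1 *: w = 0 /\ x ^+ n *: w != 0.
Proof.
apply: (dsum_unbounded ringD_domain maxD1) => {}x x0 xm.
have gx : (x != 0) && (x \in @maxD k) by rewrite x0.
by exists (exist _ x gx).
Qed.

Lemma idealI_gen : @idealI k =i ideal_gen [:: ((s, 0) : ringA k); ((t, 0) : ringA k)].
Proof. by []. Qed.
End Plane.

Theorem corollary4p4 (k : fieldType) :
  HMCM (ringB k) /\ ~ HMCM {poly (ringB k)}.
Proof.
split.
  exact: (HMCM_double_idealization (@ringD_domain k) (@idealI_gen k)
    (@maxD_unit k) (@modM_unbounded k)).
exact: (not_HMCM_poly_double_idealization (@ringD_domain k) (@idealI_gen k)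
  (maxD1 k) (tD_neq0 k) (@modM_torsion k)).
Qed.
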